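(* Let $\mathbb{G}$ be a compact quantum group, let $A$ be a unital C*-algebra, and let $\delta$ be an action of $\mathbb{G}$ on $A$. If $\dim_{\rm WLT}(\delta)<\infty$, then $\delta$ is free.
   Context: All tensor products of C*-algebras are minimal. Compact quantum group $\mathbb{G}$: a unital C*-algebra $C(\mathbb{G})$ with a unital injective $*$-homomorphism $\Delta\colon C(\mathbb{G})\to C(\mathbb{G})\otimes C(\mathbb{G})$ such that $({\rm id}\otimes\Delta)\Delta=(\Delta\otimes{\rm id})\Delta$ and the closed linear spans of $\{(a\otimes 1)\Delta(b)\}$ and of $\{(1\otimes a)\Delta(b)\}$ ($a,b\in C(\mathbb{G})$) both equal $C(\mathbb{G})\otimes C(\mathbb{G})$. Action of $\mathbb{G}$ on $A$ (= coaction of $C(\mathbb{G})$ on $A$): a unital injective $*$-homomorphism $\delta\colon A\to A\otimes C(\mathbb{G})$ with $(\delta\otimes {\rm id})\delta=({\rm id}\otimes\Delta)\delta$ and such that the closed linear span of $\{(1\otimes h)\delta(a): a\in A,h\in C(\mathbb{G})\}$ is $A\otimes C(\mathbb{G})$. A $*$-homomorphism $f\colon A\to B$ between algebras with coactions $\delta_A,\delta_B$ is $\mathbb{G}$-equivariant if $\delta_B\circ f=(f\otimes{\rm id})\circ\delta_A$. The action $\delta$ is free if the closed linear span of $\{(a\otimes 1)\delta(b) : a,b\in A\}$ equals $A\otimes C(\mathbb{G})$. Let ${\rm t}\in C_0((0,1])$ be the inclusion function $(0,1]\hookrightarrow\mathbb{C}$, and let $\mathbb{G}$ act on $C_0((0,1])\otimes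 C(\mathbb{G})$ via ${\rm id}\otimes\Delta$. The weak local-triviality dimension $\dim_{\rm WLT}(\delta)$ is the minimal integer $d\ge 0$ such that there exist $\mathbb{G}$-equivariant (not necessarily unital) $*$-homomorphisms $\rho_0,\ldots,\rho_d\colon C_0((0,1])\otimes C(\mathbb{G})\to A$ with $\sum_{j=0}^d\rho_j({\rm t}\otimes 1)$ invertible in $A$; it is $\infty$ if no such $d$ exists. *)

(* Defs.v *)
From HB Require Import structures.
From mathcomp Require Import all_boot all_order all_algebra.
From mathcomp Require Import complex.
From mathcomp Require Import all_classical all_reals all_analysis.
From mathcomp Require Import ring lra.

Set Implicit Arguments.
Unset Strict Implicit.
Unset Printing Implicit Defensive.

Import Order.TTheory GRing.Theory Num.Theory.
Import numFieldNormedType.Exports.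

Local Open Scope classical_set_scope.
Local Open Scope complex_scope.
Local Open Scope ring_scope.

(* Norms on an R[i]-module take their values in R[i]; [rnorm] is the norm as an
   element of R. *)
Section real_norm.
Context {R : realType} {V : normedModType R[i]}.

Definition rnorm (x : V) : R := complex.Re `|x|.

Lemma rnormE (x : V) : (rnorm x)%:C = `|x|.
Proof. by rewrite RRe_real. Qed.

Lemma rnorm_ge0 (x : V) : 0 <= rnorm x.
Proof. by rewrite -lecR rnormE; exact: normr_ge0. Qed.

Lemma rnorm_triangle (x y : V) : rnorm (x + y) <= rnorm x + rnorm y.
Proof. by rewrite -lecR [leRHS]rmorphD /= !rnormE ler_normD. Qed.

Lemma rnorm_le (x : V) (e : R) : (rnorm x <= e) = (`|x| <= e%:C).
Proof. by rewrite -lecR rnormE. Qed.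

Lemma rnorm_eq0 (x : V) : rnorm x = 0 -> x = 0.
Proof. by move=> x0; apply/eqP; rewrite -normr_eq0 -rnormE x0. Qed.

Lemma rnormN (x : V) : rnorm (- x) = rnorm x.
Proof. by rewrite /rnorm normrN. Qed.

Lemma rnormZ (c : R[i]) (x : V) : rnorm (c *: x) = complex.Re `|c| * rnorm x.
Proof.
by apply: (@complexI R); rewrite rmorphM /= !rnormE normrZ ?RRe_real.
Qed.

Lemma ltcR_ex (e : R[i]) : 0 < e -> exists2 d : R, 0 < d & d%:C = e.
Proof.
move=> e0; have eR := RRe_real (gtr0_real e0).
by exists (complex.Re e) => //; rewrite -ltcR eR.
Qed.

Lemma rnorm_continuous : continuous rnorm.
Proof.
move=> x; apply/cvgrPdist_le => e e0; near=> y.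
have : rnorm (x - y) <= e.
  by rewrite rnorm_le; near: y; move: (@cvg_id _ (nbhs x)) => /cvgrPdist_le; apply; rewrite ltcR.
apply: le_trans; rewrite ler_norml; apply/andP; split.
  rewrite lerNl opprB lerBlDr; have := rnorm_triangle (y - x) x.
  by rewrite subrK -(rnormN (y - x)) opprB.
by rewrite lerBlDr; have := rnorm_triangle (x - y) y; rewrite subrK.
Unshelve. all: by end_near. Qed.

End real_norm.

Section complex_complete.
Context {R : realType}.

Let Re_rnorm (z : R[i]^o) : `|complex.Re z| <= rnorm z.
Proof. by rewrite -lecR rnormE; exact: normc_ge_Re. Qed.

Let Im_rnorm (z : R[i]^o) : `|complex.Im z| <= rnorm z.
Proof.
case: z => a b; rewrite /rnorm normc_def /= -[leLHS]sqrtr_sqr.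
by rewrite ler_wsqrtr// lerDr sqr_ge0.
Qed.

Let rnorm_ReIm (z : R[i]^o) : rnorm z <= `|complex.Re z| + `|complex.Im z|.
Proof.
case: z => a b; rewrite /rnorm normc_def /=.
rewrite -[leRHS]ger0_norm ?addr_ge0// -[leRHS]sqrtr_sqr ler_wsqrtr//.
by rewrite sqrrD !real_normK ?num_real// lerD2r lerDl mulrn_wge0//.
Qed.

Lemma complex_complete (F : set_system R[i]^o) :
  ProperFilter F -> cauchy F -> cvg F.
Proof.
move=> FF /cauchyP Fc.
have aux (p : R[i]^o -> R) : (forall z w, p (z - w) = p z - p w) ->
    (forall z, `|p z| <= rnorm z) -> cvg (p @ F).
  move=> pB ple; apply: cauchy_cvg; apply: cauchy_exP => e e0.
  have /Fc [z Fz] : 0 < e%:C by rewrite ltcR.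
  exists (p z); rewrite /nbhs/=; apply: filterS Fz => w /=.
  rewrite /ball /= -rnormE ltcR; apply: le_lt_trans.
  by rewrite -pB.
have /cvg_ex[/= a Fa] : cvg (@complex.Re R @ F).
  by apply: aux => // -[? ?] [? ?].
have /cvg_ex[/= b Fb] : cvg (@complex.Im R @ F).
  by apply: aux => // -[? ?] [? ?].
apply/cvg_ex; exists (a +i* b : R[i]^o); apply/cvgrPdist_le => _ /ltcR_ex[e e0 <-].
near=> z; rewrite -rnorm_le; apply: (le_trans (rnorm_ReIm _)).
rewrite [leRHS]splitr lerD//.
  have -> : complex.Re ((a +i* b)%C - z) = a - complex.Re z by case: (z).
  by near: z; move: Fa => /cvgrPdist_le; apply; rewrite divr_gt0.
have -> : complex.Im ((a +i* b)%C - z) = b - complex.Im z by case: (z).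
by near: z; move: Fb => /cvgrPdist_le; apply; rewrite divr_gt0.
Unshelve. all: by end_near. Qed.

End complex_complete.

(* The C*-algebra of continuous functions vanishing at infinity on X. *)
Section C0_def.
Context (R : realType) (X : topologicalType).

Definition vanishing_at_infty (f : X -> R[i]^o) :=
  forall e : R, 0 < e -> compact [set x | e <= rnorm (f x)].

Definition C0_pred : {pred X -> R[i]^o} :=
  [pred f | `[< continuous f /\ vanishing_at_infty f >]].

Lemma C0_predP (f : X -> R[i]^o) :
  reflect (continuous f /\ vanishing_at_infty f) (f \in C0_pred).
Proof. exact: asboolP. Qed.

Lemma closed_rnorm_ge (f : X -> R[i]^o) (e : R) :
  continuous f -> closed [set x | e <= rnorm (f x)].
Proof.
move=> cf; apply: (@closed_comp _ _ (fun x => rnorm (f x)) [set y | e <= y]).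
  by move=> x _; apply: continuous_comp; [exact: cf|exact: rnorm_continuous].
exact: closed_ge.
Qed.

Lemma C0_submod_closed : submod_closed C0_pred.
Proof.
split=> [|c f g /C0_predP[cf vf] /C0_predP[cg vg]]; apply/C0_predP; split.
- by move=> x; exact: cvg_cst.
- move=> e e0; rewrite (_ : [set _ | _] = set0); first exact: compact0.
  by apply/seteqP; split=> x //=; rewrite /rnorm normr0 leNgt e0.
- by move=> x; apply: cvgD; [apply: cvgZr; exact: cf|exact: cg].
have cfg : continuous (c *: f + g).
  by move=> x; apply: cvgD; [apply: cvgZr; exact: cf|exact: cg].
move=> e e0; pose k := complex.Re `|c|.
have k0 : 0 <= k by exact: (rnorm_ge0 (c : R[i]^o)).
pose d := e / 2 / (k + 1).
have d0 : 0 < d by rewrite !divr_gt0// ltr_wpDl.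
apply: (@subclosed_compact _ _
  ([set x | d <= rnorm (f x)] `|` [set x | e / 2 <= rnorm (g x)])).
- exact: closed_rnorm_ge.
- by apply: compactU; [exact: vf|apply: vg; rewrite divr_gt0].
move=> x /= ex; have [|fd] := leP d (rnorm (f x)); first by left.
right; rewrite leNgt; apply/negP => ge.
move: ex; rewrite leNgt => /negP; apply.
apply: (le_lt_trans (rnorm_triangle _ _)).
rewrite [ltRHS]splitr ler_ltD// rnormZ -/k.
apply: (@le_trans _ _ ((k + 1) * d)); last by rewrite mulrC divfK// gt_eqF// ltr_wpDl.
by rewrite ler_pM ?rnorm_ge0// ?lerDl// ltW.
Qed.

HB.instance Definition _ :=
  GRing.isSubmodClosed.Build _ _ C0_pred C0_submod_closed.

Record C0 := MkC0 { C0_fun :> X -> R[i]^o; _ : C0_fun \in C0_pred }.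

HB.instance Definition _ := [isSub for C0_fun].
HB.instance Definition _ := [Choice of C0 by <:].
HB.instance Definition _ := [SubChoice_isSubLmodule of C0 by <:].

Lemma C0_continuous (f : C0) : continuous f.
Proof. by have /C0_predP[] := valP f. Qed.

Lemma C0_vanishing (f : C0) : vanishing_at_infty f.
Proof. by have /C0_predP[] := valP f. Qed.

Lemma C0_has_ubound (f : C0) : has_ubound (range (fun x => rnorm (f x))).
Proof.
have cf : continuous (fun x => rnorm (f x)).
  by move=> x; apply: continuous_comp;
    [exact: C0_continuous|exact: rnorm_continuous].
have fS := @C0_vanishing f _ ltr01.
have /compact_bounded[M [_ /(_ (M + 1))]] :=
  continuous_compact (continuous_subspaceT cf) fS.
rewrite ltrDl => /(_ ltr01) fM; exists (Num.max 1 (M + 1)) => _ [x _ <-].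
have [x1|/ltW x1] := leP 1 (rnorm (f x)); last by rewrite le_max x1.
rewrite le_max; apply/orP; right.
by rewrite -[leLHS]ger0_norm ?rnorm_ge0//; apply: fM => /=; exists x.
Qed.

Definition C0_norm (f : C0) : R := sup (range (fun x => rnorm (f x))).

Lemma C0_norm_ge (f : C0) x : rnorm (f x) <= C0_norm f.
Proof. by apply: ub_le_sup; [exact: C0_has_ubound|exists x]. Qed.

Lemma C0_norm_le (f : C0) (M : R) :
  0 <= M -> (forall x, rnorm (f x) <= M) -> C0_norm f <= M.
Proof.
move=> M0 fM; have [[x _]|X0] := pselect ([set: X] !=set0).
  by apply: ge_sup => [|_ [y _ <-]//]; exists (rnorm (f x)), x.
suff : range (fun x => rnorm (f x)) = set0 by rewrite /C0_norm => ->; rewrite sup0.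
by rewrite -subset0 => y [x _ _]; case: X0; exists x.
Qed.

Lemma C0_norm_ge0 (f : C0) : 0 <= C0_norm f.
Proof.
have [[x _]|X0] := pselect ([set: X] !=set0).
  exact: le_trans (rnorm_ge0 (f x)) (C0_norm_ge _ _).
suff : range (fun x => rnorm (f x)) = set0 by rewrite /C0_norm => ->; rewrite sup0.
by rewrite -subset0 => y [x _ _]; case: X0; exists x.
Qed.

Let C0_ler_normD (f g : C0) :
  (C0_norm (f + g))%:C <= (C0_norm f)%:C + (C0_norm g)%:C.
Proof.
rewrite -rmorphD lecR /=; apply: C0_norm_le => [|x].
  by rewrite addr_ge0// C0_norm_ge0.
by apply: (le_trans (rnorm_triangle _ _)); rewrite lerD// C0_norm_ge.
Qed.

Let C0_normrZ (c : R[i]) (f : C0) : (C0_norm (c *: f))%:C = `|c| * (C0_norm f)%:C.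
Proof.
rewrite -[`|c|](@RRe_real R)// -rmorphM; congr (_ %:C).
have c0 : 0 <= complex.Re `|c| by exact: (rnorm_ge0 (c : R[i]^o)).
apply/eqP; rewrite eq_le; apply/andP; split.
  apply: C0_norm_le => [|x]; first by rewrite mulr_ge0// C0_norm_ge0.
  by rewrite rnormZ ler_wpM2l// C0_norm_ge.
have [->|c_neq0] := eqVneq c 0.
  by rewrite normr0 mul0r C0_norm_ge0.
have {}c0 : 0 < complex.Re `|c|.
  by rewrite lt_neqAle c0 andbT eq_sym; apply: contra c_neq0 => /eqP h;
    apply/eqP/(rnorm_eq0 (x := c : R[i]^o)).
rewrite -ler_pdivlMl//; apply: C0_norm_le => [|x].
  by rewrite mulr_ge0 ?C0_norm_ge0// invr_ge0 ltW.
by rewrite ler_pdivlMl// -rnormZ; exact: (C0_norm_ge (c *: f)).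
Qed.

Let C0_normr0_eq0 (f : C0) : (C0_norm f)%:C = 0 :> R[i] -> f = 0.
Proof.
move=> /complexI f0; apply/val_inj/funext => x; apply: rnorm_eq0.
by apply/eqP; rewrite eq_le rnorm_ge0 andbT -f0 C0_norm_ge.
Qed.

HB.instance Definition _ :=
  Lmodule_isNormed.Build R[i] C0 C0_ler_normD C0_normrZ C0_normr0_eq0.

Lemma C0_rnormE (f : C0) : rnorm f = C0_norm f.
Proof. by []. Qed.

Let C0_complete (F : set_system C0) : ProperFilter F -> cauchy F -> cvg F.
Proof.
move=> FF /cauchyP Fc.
have Fe (e : R) : 0 < e -> exists f : C0, \forall g \near F, rnorm (f - g) <= e.
  rewrite -ltcR => /Fc[f Ff]; exists f.
  by apply: filterS Ff => g; rewrite /ball/= rnorm_le => /ltW.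
have cvgx x : cvg ((fun f : C0 => f x : R[i]^o) @ F).
  apply: complex_complete; apply: cauchy_exP => _ /ltcR_ex[e e0 <-].
  have [|f Ff] := Fe (e / 2); first by rewrite divr_gt0.
  exists (f x); apply: filterS Ff => g /= fg.
  rewrite /ball /= -rnormE ltcR; apply: le_lt_trans (C0_norm_ge (f - g) x) _.
  by apply: le_lt_trans fg _; rewrite ltr_pdivrMr// ltr_pMr// ltr1n.
pose g x := lim ((fun f : C0 => f x : R[i]^o) @ F).
have gE (e : R) (f : C0) : (\forall h \near F, rnorm (f - h) <= e) ->
    forall x, rnorm (f x - g x) <= e.
  move=> Ff x; apply/ler_addgt0Pr => d d0.
  have /cvgrPdist_le/(_ d%:C) := cvgx x; rewrite ltcR => /(_ d0) gd.
  near F => h.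
  have -> : f x - g x = (f - h) x + (h x - g x) by rewrite addrA subrK.
  apply: le_trans (rnorm_triangle _ _) _; apply: lerD.
    by apply: le_trans (C0_norm_ge _ _) _; near: h.
  by rewrite -rnormN opprB rnorm_le; near: h.
have cg : continuous g.
  move=> x; apply/cvgrPdist_le => _ /ltcR_ex[e e0 <-].
  have e30 : 0 < e / 3 by rewrite divr_gt0.
  have [f /gE fg] := Fe _ e30.
  near=> y; rewrite -rnorm_le.
  have -> : g x - g y = (g x - f x) + ((f x - f y) + (f y - g y)).
    by rewrite !addrA !subrK.
  have -> : e = e / 3 + (e / 3 + e / 3) by field.
  apply: le_trans (rnorm_triangle _ _) _; apply: lerD.
    by rewrite -rnormN opprB.
  apply: le_trans (rnorm_triangle _ _) _; apply: lerD => //.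
  rewrite rnorm_le; near: y.
  by have /cvgrPdist_le := @C0_continuous f x; apply; rewrite ltcR.
have vg : vanishing_at_infty g.
  move=> e e0; have e20 : 0 < e / 2 by rewrite divr_gt0.
  have [f /gE fg] := Fe _ e20.
  apply: (@subclosed_compact _ _ [set x | e / 2 <= rnorm (f x)]).
  - exact: closed_rnorm_ge.
  - exact: C0_vanishing.
  move=> x /= ex; rewrite -(lerD2r (e / 2)) -splitr (le_trans ex)//.
  have -> : g x = f x + (g x - f x) by rewrite addrC subrK.
  apply: le_trans (rnorm_triangle _ _) _; apply: lerD => //.
  by rewrite -rnormN opprB.
have /C0_predP g0 := conj cg vg.
apply/cvg_ex; exists (MkC0 g0); apply/cvgrPdist_le => _ /ltcR_ex[e e0 <-].
have e20 : 0 < e / 2 by rewrite divr_gt0.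
have [f Ff] := Fe _ e20; near=> h; rewrite -rnorm_le.
apply: C0_norm_le => [|x]; first exact: ltW.
have -> : (MkC0 g0 - h) x = (g x - f x) + (f - h) x.
  by rewrite /= addrA subrK.
rewrite [leRHS]splitr; apply: le_trans (rnorm_triangle _ _) _; apply: lerD.
  by rewrite -rnormN opprB; exact: gE.
by apply: le_trans (C0_norm_ge _ _) _; near: h.
Unshelve. all: by end_near. Qed.

HB.instance Definition _ := Uniform_isComplete.Build C0 C0_complete.

End C0_def.

(* C*-algebras over the complex numbers R[i].  MathComp rings are unital, and
   C_0((0, 1]) (x) C(G) is not, hence a separate multiplication. *)
HB.mixin Record CompleteNormedModule_isCStarAlgebra (R : realType) A
    & CompleteNormedModule R[i] A := {
  cmul : A -> A -> A ;
  adj : A -> A ;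
  cmulA : associative cmul ;
  cmulDl : left_distributive cmul +%R ;
  cmulDr : right_distributive cmul +%R ;
  cscalerAl : forall (c : R[i]) a b, c *: cmul a b = cmul (c *: a) b ;
  cscalerAr : forall (c : R[i]) a b, c *: cmul a b = cmul a (c *: b) ;
  adjK : involutive adj ;
  adjD : {morph adj : a b / a + b} ;
  adjZ : forall (c : R[i]) a, adj (c *: a) = conjc c *: adj a ;
  adjM : forall a b, adj (cmul a b) = cmul (adj b) (adj a) ;
  cnormM_le : forall a b, `|cmul a b| <= `|a| * `|b| ;
  cnorm_adj : forall a, `|cmul (adj a) a| = `|a| ^+ 2
}.

#[short(type="cstarType")]
HB.structure Definition CStarAlgebra (R : realType) :=
  {A of CompleteNormedModule R[i] A & CompleteNormedModule_isCStarAlgebra R A}.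

HB.mixin Record CStarAlgebra_isUnital (R : realType) A & CStarAlgebra R A := {
  uone : A ;
  cmul1 : left_id uone (@cmul R A) ;
  cmulr1 : right_id uone (@cmul R A)
}.

#[short(type="ucstarType")]
HB.structure Definition UnitalCStarAlgebra (R : realType) :=
  {A of CStarAlgebra R A & CStarAlgebra_isUnital R A}.

Arguments uone {R s}.
Notation "a ** b" := (cmul a b) (at level 40, left associativity) : ring_scope.

Definition cinvertible (R : realType) (A : ucstarType R) (a : A) :=
  exists b : A, a ** b = uone /\ b ** a = uone.

Definition closed_span (R : realType) (V : normedModType R[i]) (S : set V) :
    set V :=
  closure [set v | exists2 s : seq (R[i] * V),
    (forall p, p \in s -> S p.2) & v = \sum_(p <- s) p.1 *: p.2].

Record starHom (R : realType) (A B : cstarType R) := StarHom {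
  hom_fun :> {linear A -> B} ;
  homM : forall a b, hom_fun (a ** b) = hom_fun a ** hom_fun b ;
  hom_adj : forall a, hom_fun (adj a) = adj (hom_fun a)
}.

Definition hom_id (R : realType) (A : cstarType R) : starHom A A :=
  @StarHom R A A idfun (fun _ _ => erefl) (fun=> erefl).

(* inner products are linear in the first variable *)
Record hilbertSpace (R : realType) := HilbertSpace {
  hs_sort :> completeNormedModType R[i] ;
  ip : hs_sort -> hs_sort -> R[i] ;
  ip_linear : forall (c : R[i]) x y z, ip (c *: x + y) z = c * ip x z + ip y z ;
  ip_conj : forall x y, ip y x = conjc (ip x y) ;
  ip_norm : forall x, ip x x = `|x| ^+ 2
}.

Record representation (R : realType) (A : cstarType R) (H : hilbertSpace R) :=
    Representation {
  rep_op :> A -> {linear H -> H} ;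
  rep_cont : forall a, continuous (rep_op a) ;
  rep_linear : forall (c : R[i]) a b x,
    rep_op (c *: a + b) x = c *: rep_op a x + rep_op b x ;
  repM : forall a b x, rep_op (a ** b) x = rep_op a (rep_op b x) ;
  rep_adj : forall a x y, ip (rep_op a x) y = ip x (rep_op (adj a) y)
}.

Section spatial_norm.
Context (R : realType).

(* [formal_norm v] is the Hilbert-space norm of the vector
   \sum_((x, y) <- v) x (x) y of the algebraic tensor product of H and K. *)
Definition formal_norm (H K : hilbertSpace R) (v : seq (H * K)) : R :=
  Num.sqrt (complex.Re
    (\sum_(p <- v) \sum_(q <- v) ip p.1 q.1 * ip p.2 q.2)).

(* [spatial_norm s] is the supremum, over all representations pi of A on H
   and sigma of B on K, of the operator norm on the Hilbert-space tensor product
   of H and K of the image under pi (x) sigma of \sum_((a, b) <- s) a (x) b.  The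
   operator norm is computed on the dense algebraic tensor product. *)
Definition spatial_norm (A B : cstarType R) (s : seq (A * B)) : \bar R :=
  ereal_sup [set r | exists (H K : hilbertSpace R)
    (pi : representation A H) (sigma : representation B K) (v : seq (H * K)),
    formal_norm v <= 1 /\
    r = (formal_norm [seq (pi x.1 p.1, sigma x.2 p.2) | x <- s, p <- v])%:E].

End spatial_norm.

(* The minimal tensor product of C*-algebras.  [mt_obj A B] is the completion of
   the algebraic tensor product for the spatial norm: this determines it up to a
   unique isomorphism compatible with the elementary tensors [mt_pure a b].
   [mt_map f g] is f (x) g and [mt_assoc] is the canonical identification of
   A (x) (B (x) C) with (A (x) B) (x) C; being continuous, both are determined by
   their values on elementary tensors. *)
Record minTensor (R : realType) := MinTensor {
  mt_obj : cstarType R -> cstarType R -> cstarType R ;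
  mt_pure : forall A B : cstarType R, A -> B -> mt_obj A B ;
  mt_linearl : forall (A B : cstarType R) (b : B),
    linear (fun a : A => mt_pure a b) ;
  mt_linearr : forall (A B : cstarType R) (a : A),
    linear (fun b : B => mt_pure a b) ;
  mt_pureM : forall (A B : cstarType R) (a a' : A) (b b' : B),
    mt_pure a b ** mt_pure a' b' = mt_pure (a ** a') (b ** b') ;
  mt_pure_adj : forall (A B : cstarType R) (a : A) (b : B),
    adj (mt_pure a b) = mt_pure (adj a) (adj b) ;
  mt_norm : forall (A B : cstarType R) (s : seq (A * B)),
    (rnorm (\sum_(x <- s) mt_pure x.1 x.2))%:E = spatial_norm s ;
  mt_dense : forall A B : cstarType R,
    closed_span [set x : mt_obj A B | exists a b, x = mt_pure a b] = setT ;
  mt_map : forall A B A' B' : cstarType R,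
    starHom A A' -> starHom B B' -> starHom (mt_obj A B) (mt_obj A' B') ;
  mt_mapE : forall (A B A' B' : cstarType R)
    (f : starHom A A') (g : starHom B B') (a : A) (b : B),
    mt_map f g (mt_pure a b) = mt_pure (f a) (g b) ;
  mt_map_cont : forall (A B A' B' : cstarType R)
    (f : starHom A A') (g : starHom B B'), continuous (mt_map f g) ;
  mt_assoc : forall A B C : cstarType R,
    starHom (mt_obj A (mt_obj B C)) (mt_obj (mt_obj A B) C) ;
  mt_assocE : forall (A B C : cstarType R) (a : A) (b : B) (c : C),
    mt_assoc A B C (mt_pure a (mt_pure b c)) = mt_pure (mt_pure a b) c ;
  mt_assoc_cont : forall A B C : cstarType R, continuous (mt_assoc A B C)
}.

Arguments mt_pure {R m A B}.
Arguments mt_map {R m A B A' B'}.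
Arguments mt_assoc {R m A B C}.

Section C0_cstar.
Context (R : realType) (X : topologicalType).
Notation C0 := (C0 R X).

Let rnorm_mul (a b : R[i]^o) : rnorm (a * b : R[i]^o) = rnorm a * rnorm b.
Proof. exact: (rnormZ a b). Qed.

Let rnorm_conj (a : R[i]^o) : rnorm (conjc a : R[i]^o) = rnorm a.
Proof. by rewrite /rnorm normcJ. Qed.

Let mul_subproof (f g : C0) : (fun x => f x * g x : R[i]^o) \in @C0_pred R X.
Proof.
have cfg : continuous (fun x => f x * g x : R[i]^o).
  by move=> x; apply: cvgM; exact: C0_continuous.
apply/C0_predP; split=> // e e0.
pose d := e / (C0_norm f + 1).
have f1 : 0 < C0_norm f + 1 by rewrite ltr_wpDl// C0_norm_ge0.
have d0 : 0 < d by rewrite divr_gt0.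
apply: (@subclosed_compact _ _ [set x | d <= rnorm (g x)]).
- exact: closed_rnorm_ge.
- exact: C0_vanishing.
move=> x /=; rewrite rnorm_mul => ex; rewrite /d ler_pdivrMr//.
rewrite (le_trans ex)// mulrC ler_wpM2l ?rnorm_ge0//.
by rewrite (le_trans (C0_norm_ge f x))// lerDl.
Qed.

Let adj_subproof (f : C0) : (fun x => conjc (f x) : R[i]^o) \in @C0_pred R X.
Proof.
apply/C0_predP; split=> [x|e e0].
  apply/cvgrPdist_le => e e0.
  have /cvgrPdist_le/(_ e e0) := @C0_continuous _ _ f x.
  by apply: filterS => y; rewrite -rmorphB -[X in _ -> X <= _]/(`|(f x - f y)^*%C|) normcJ.
have := @C0_vanishing _ _ f e e0.
by congr compact; apply: eq_set => x; rewrite rnorm_conj.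
Qed.

Definition C0_mul (f g : C0) : C0 := MkC0 (mul_subproof f g).
Definition C0_adj (f : C0) : C0 := MkC0 (adj_subproof f).

Let C0_normM_le (f g : C0) : `|C0_mul f g| <= `|f| * `|g|.
Proof.
rewrite -!rnormE -rmorphM lecR; apply: C0_norm_le => [|x].
  by rewrite mulr_ge0// rnorm_ge0.
by rewrite rnorm_mul ler_pM ?rnorm_ge0//; exact: C0_norm_ge.
Qed.

Let C0_norm_adj (f : C0) : `|C0_mul (C0_adj f) f| = `|f| ^+ 2.
Proof.
apply/eqP; rewrite -!rnormE -rmorphXn /= (inj_eq (@complexI R)) eq_le.
apply/andP; split.
  apply: C0_norm_le => [|x]; first by rewrite sqr_ge0.
  rewrite rnorm_mul rnorm_conj -expr2 ler_pXn2r ?nnegrE ?rnorm_ge0//.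
  exact: C0_norm_ge.
have n0 : 0 <= rnorm (C0_mul (C0_adj f) f) by exact: rnorm_ge0.
rewrite -(sqr_sqrtr n0) ler_pXn2r ?nnegrE ?rnorm_ge0 ?sqrtr_ge0//.
apply: C0_norm_le => [|x]; first exact: sqrtr_ge0.
rewrite -[leLHS]ger0_norm ?rnorm_ge0// -sqrtr_sqr ler_wsqrtr//.
rewrite expr2 -{1}rnorm_conj -rnorm_mul.
exact: (C0_norm_ge (C0_mul (C0_adj f) f)).
Qed.

Let C0_mulA : associative C0_mul.
Proof. by move=> f g h; apply/val_inj/funext => x; exact: mulrA. Qed.

Let C0_mulDl : left_distributive C0_mul +%R.
Proof. by move=> f g h; apply/val_inj/funext => x; exact: mulrDl. Qed.

Let C0_mulDr : right_distributive C0_mul +%R.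
Proof. by move=> f g h; apply/val_inj/funext => x; exact: mulrDr. Qed.

Let C0_scalerAl : forall (c : R[i]) f g, c *: C0_mul f g = C0_mul (c *: f) g.
Proof. by move=> c f g; apply/val_inj/funext => x; exact: mulrA. Qed.

Let C0_scalerAr : forall (c : R[i]) f g, c *: C0_mul f g = C0_mul f (c *: g).
Proof. by move=> c f g; apply/val_inj/funext => x; exact: mulrCA. Qed.

Let C0_adjK : involutive C0_adj.
Proof. by move=> f; apply/val_inj/funext => x; exact: conjcK. Qed.

Let C0_adjD : {morph C0_adj : f g / f + g}.
Proof. by move=> f g; apply/val_inj/funext => x; exact: (rmorphD (@conjc R)). Qed.

Let C0_adjZ : forall (c : R[i]) f, C0_adj (c *: f) = conjc c *: C0_adj f.
Proof. by move=> c f; apply/val_inj/funext => x; exact: (rmorphM (@conjc R)). Qed.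

Let C0_adjM : forall f g, C0_adj (C0_mul f g) = C0_mul (C0_adj g) (C0_adj f).
Proof. by move=> f g; apply/val_inj/funext => x; rewrite /= [RHS]mulrC; exact: (rmorphM (@conjc R)). Qed.

HB.instance Definition _ :=
  @CompleteNormedModule_isCStarAlgebra.Build R C0 C0_mul C0_adj
    C0_mulA C0_mulDl C0_mulDr C0_scalerAl C0_scalerAr
    C0_adjK C0_adjD C0_adjZ C0_adjM C0_normM_le C0_norm_adj.

End C0_cstar.

Section half_open_interval.
Context (R : realType).

Definition Ioc01 : set R := [set x | 0 < x <= 1].

Let t_fun (x : Ioc01) : R[i]^o := (set_val x)%:C.

Let rnorm_t (x : Ioc01) : rnorm (t_fun x) = set_val x.
Proof.
have := set_valP x; rewrite /= => /andP[x0 _].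
by rewrite /rnorm normc_def /= expr0n addr0 sqrtr_sqr gtr0_norm.
Qed.

Let t_subproof : t_fun \in @C0_pred R Ioc01.
Proof.
apply/C0_predP; split=> [x|e e0 F FF Fe].
  apply/(@cvgrPdist_le _ _ _ (nbhs x)) => _ /ltcR_ex[e e0 <-].
  have xe : \forall y \near x, `|set_val x - set_val y| <= e.
    have : (set_val : Ioc01 -> R) y @[y --> x] --> (set_val x : R).
      exact: initial_continuous.
    by move=> /cvgrPdist_le; apply.
  near=> y; rewrite -rmorphB normc_def /= expr0n addr0 sqrtr_sqr lecR.
  by near: y.
have [|p [/= pe1 Fp]] := @segment_compact R e 1 (set_val @ F) _.
  suff : F (set_val @^-1` `[e, 1]%classic) by [].
  apply: filterS Fe => x ex; have /andP[_ x1] := set_valP x.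
  have {}ex : e <= set_val x by rewrite -rnorm_t.
  by rewrite /= in_itv /=; apply/andP.
have {pe1}/andP[ep p1] : e <= p <= 1 by move: pe1; rewrite /= ?in_itv.
have p01 : p \in Ioc01.
  by apply/mem_set; rewrite /Ioc01 /= p1 (lt_le_trans e0 ep).
exists (exist _ p p01 : Ioc01); split.
  by rewrite -[p]/(set_val (exist _ p p01 : Ioc01)) -rnorm_t in ep.
move=> A B FA [_ [/= [W oW <-] /= Wp] WB].
have [|_ [[x Ax <-] Wx]] := Fp (set_val @` A) W _ (open_nbhs_nbhs (conj oW Wp)).
  suff : F (set_val @^-1` (set_val @` A)) by [].
  by apply: filterS FA => x Ax; exists x.
by exists x; split=> //; exact: WB.
Unshelve. all: by end_near. Qed.

(* the inclusion function t of (0, 1] into the complex numbers *)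
Definition tC0 : C0 R Ioc01 := MkC0 t_subproof.
End half_open_interval.
Arguments Ioc01 : clear implicits.

Section quantum_groups.
Context (R : realType) (M : minTensor R).

Local Notation "A \ot B" := (mt_obj M A B) (at level 35).
Local Notation "a \ox b" := (mt_pure (m := M) a b) (at level 35).

Record compactQuantumGroup := CompactQuantumGroup {
  CG :> ucstarType R ;
  comult : starHom CG (CG \ot CG) ;
  comult1 : comult uone = uone \ox uone ;
  comult_inj : injective comult ;
  comultA : forall h, mt_assoc (mt_map (hom_id CG) comult (comult h)) =
                      mt_map comult (hom_id CG) (comult h) ;
  comult_densel : closed_span [set x : CG \ot CG |
    exists a b : CG, x = (a \ox uone) ** comult b] = setT ;
  comult_denser : closed_span [set x : CG \ot CG |
    exists a b : CG, x = (uone \ox a) ** comult b] = setT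
}.

Record action (G : compactQuantumGroup) (A : ucstarType R) := Action {
  coact :> starHom A (A \ot G) ;
  coact1 : coact uone = uone \ox uone ;
  coact_inj : injective coact ;
  coactA : forall a, mt_map coact (hom_id G) (coact a) =
                     mt_assoc (mt_map (hom_id A) (comult G) (coact a)) ;
  coact_dense : closed_span [set x : A \ot G |
    exists (h : G) (a : A), x = (uone \ox h) ** coact a] = setT
}.

Definition equivariant (G : compactQuantumGroup) (A B : cstarType R)
    (deltaA : A -> A \ot G) (deltaB : B -> B \ot G) (f : starHom A B) :=
  forall a, deltaB (f a) = mt_map f (hom_id G) (deltaA a).

Definition free_action (G : compactQuantumGroup) (A : ucstarType R)
    (delta : action G A) :=
  closed_span [set x : A \ot G |
    exists a b : A, x = (a \ox uone) ** delta b] = setT.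

(* id (x) Delta on C_0((0, 1]) (x) C(G) *)
Definition cone_coact (G : compactQuantumGroup)
    (x : C0 R (Ioc01 R) \ot G) :
    (C0 R (Ioc01 R) \ot G) \ot G :=
  mt_assoc (mt_map (hom_id _) (comult G) x).

Definition WLT_le (G : compactQuantumGroup) (A : ucstarType R)
    (delta : action G A) (d : nat) :=
  exists rho : 'I_d.+1 -> starHom (C0 R (Ioc01 R) \ot G) A,
    (forall j, equivariant (@cone_coact G) delta (rho j)) /\
    cinvertible (\sum_(j < d.+1) rho j (tC0 R \ox uone)).

(* the infimum of a set of integers is its minimum, and +oo if it is empty *)
Definition dim_WLT (G : compactQuantumGroup) (A : ucstarType R)
    (delta : action G A) : \bar R :=
  ereal_inf [set (d%:R)%:E | d in WLT_le delta].

End quantum_groups.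

(* Main.v *)
Require Import Defs.
From mathcomp Require Import all_boot all_order all_algebra.
From mathcomp Require Import complex.
From mathcomp Require Import all_classical all_reals all_analysis.
From mathcomp Require Import ring lra.

Set Implicit Arguments.
Unset Strict Implicit.
Unset Printing Implicit Defensive.

Import Order.TTheory GRing.Theory Num.Theory.
Import numFieldNormedType.Exports.

Local Open Scope classical_set_scope.
Local Open Scope complex_scope.
Local Open Scope ring_scope.

(** Write C for the closed span of the products (a (x) 1) delta(b); it is stable
    under left multiplication by a (x) 1, so freeness follows once 1 (x) h lies
    in C for every h in C(G).

    Let rho be an equivariant homomorphism on the cone and f, g functions in
    C_0((0, 1]).  Equivariance turns the product
    (rho(f (x) a) (x) 1) delta(rho(g (x) b)) into the image under rho (x) id of
    fg (x) ((a (x) 1) Delta(b)).  The elements (a (x) 1) Delta(b) span a dense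
    subspace of C(G) (x) C(G), hence C contains the image of fg (x) x for every
    x, and x = 1 (x) h gives rho(fg (x) 1) (x) h
    ([equivariant_canonical_span]).  Taking f = g = sqrt t and summing over the
    rho_j, C contains c (x) h with c the sum of the rho_j(t (x) 1); multiplying
    on the left by c^-1 (x) 1 gives 1 (x) h.

    The passage to the closure requires x |-> f (x) x to be continuous, that is,
    the bound |a (x) b| <= |a| |b| for the spatial norm ([rnorm_pure_le]). If b
    is self-adjoint with |b| < 1, the equation b = 2c - c^2 has a self-adjoint
    solution c, the fixed point of the contraction c |-> (b + c^2)/2. Thus 1 - b
    is formally the square of 1 - c, and for a representation pi and |a| < 1 the
    defect form <x, y> - <pi(a) x, pi(a) y> is <Tx, Ty> with T = 1 - pi(c),
    where c solves the equation for b = a^* a ([rep_defect]). As the form of an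
    algebraic tensor product of Hilbert spaces is positive
    ([formal_sqnorm_ge0]), applying this to each tensor factor bounds the
    operator norm of pi(a) (x) sigma(b). *)

(** * Norm and multiplication in C*-algebras *)

Section cstar_basics.
Context {R : realType} {A : cstarType R}.
Implicit Types a b c : A.

Lemma rnormM_le a b : rnorm (a ** b) <= rnorm a * rnorm b.
Proof. by rewrite -lecR rmorphM /= !rnormE cnormM_le. Qed.

(** The C*-identity gives |a|^2 = |a^* a| <= |a^*| |a|, hence |a| <= |a^*|. *)
Lemma rnorm_adj a : rnorm (adj a) = rnorm a.
Proof.
have le_adj c : rnorm c <= rnorm (adj c).
  have [->|c0] := eqVneq (rnorm c) 0; first exact: rnorm_ge0.
  have {}c0 : 0 < rnorm c by rewrite lt_neqAle eq_sym c0 rnorm_ge0.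
  rewrite -(ler_pM2r c0) -expr2 (le_trans _ (rnormM_le _ _))//.
  by rewrite -lecR rmorphXn /= !rnormE cnorm_adj.
by apply/eqP; rewrite eq_le le_adj andbT; have := le_adj (adj a); rewrite adjK.
Qed.

Lemma cmulNr a b : a ** (- b) = - (a ** b).
Proof. by rewrite -[- b]scaleN1r -cscalerAr scaleN1r. Qed.

Lemma cmulNl a b : (- a) ** b = - (a ** b).
Proof. by rewrite -[- a]scaleN1r -cscalerAl scaleN1r. Qed.

Lemma cmulBr a b c : a ** (b - c) = a ** b - a ** c.
Proof. by rewrite cmulDr cmulNr. Qed.

Lemma cmulBl a b c : (a - b) ** c = a ** c - b ** c.
Proof. by rewrite cmulDl cmulNl. Qed.

Lemma cmul_left_linear a : linear (cmul a).
Proof. by move=> c x y; rewrite cmulDr -cscalerAr. Qed.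

End cstar_basics.

(** * Self-adjoint solutions of b = 2c - c^2 *)

Section geometric_convergence.
Context {R : realType} {V : completeNormedModType R[i]}.

Lemma ler_geometric_tail (r K x y : R) : 0 <= r < 1 ->
  (forall n, x <= y + K * r ^+ n) -> x <= y.
Proof.
move=> /andP[r0 r1] xyn.
have rn : y + K * r ^+ n @[n --> \oo] --> y + K * 0.
  apply: cvgD; first exact: cvg_cst.
  by apply: cvgMr; apply: cvg_expr; rewrite ger0_norm.
rewrite mulr0 addr0 in rn.
rewrite -(cvg_lim (@Rhausdorff R) rn); apply: limr_ge; first exact: cvgP rn.
exact: nearW.
Qed.

(** The rate of convergence is part of the conclusion so that later limits can be
    identified by [ler_geometric_tail]. *)
Lemma geometric_limit (u : nat -> V) (r : R) : 0 <= r < 1 ->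
  (forall n, rnorm (u n.+1 - u n) <= r ^+ n) ->
  exists l, forall n, rnorm (l - u n) <= (1 - r)^-1 * r ^+ n.
Proof.
move=> r01 ur; have /andP[r0 r1] := r01.
have r'0 : 0 < 1 - r by rewrite subr_gt0.
have un n k : rnorm (u (n + k)%N - u n) <= (1 - r)^-1 * r ^+ n.
  suff : rnorm (u (n + k)%N - u n) <= (1 - r)^-1 * (1 - r ^+ k) * r ^+ n.
    move=> /le_trans; apply; rewrite ler_wpM2r ?exprn_ge0//.
    by rewrite ler_piMr ?invr_ge0 ?(ltW r'0)// gerBl exprn_ge0.
  elim: k => [|k IH]; first by rewrite addn0 !subrr /rnorm normr0 mulr0 mul0r.
  rewrite addnS -[u _.+1](subrK (u (n + k)%N)) -addrA.
  apply: le_trans (rnorm_triangle _ _) _.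
  apply: le_trans (lerD (ur _) IH) _.
  rewrite exprD exprSr le_eqVlt; apply/orP; left; apply/eqP.
  by field; rewrite gt_eqF.
have rn : (1 - r)^-1 * r ^+ n @[n --> \oo] --> (1 - r)^-1 * 0.
  by apply: cvgMr; apply: cvg_expr; rewrite ger0_norm.
rewrite mulr0 in rn.
have /cvg_ex[l ul] : cvg (u @ \oo).
  apply: cauchy_cvg; apply: cauchy_exP => _ /ltcR_ex[e e0 <-].
  have [N _ /(_ N (leqnn N)) Ne] : \forall n \near \oo, (1 - r)^-1 * r ^+ n < e.
    by apply: (cvgr_lt _ rn).
  exists (u N); exists N => // n /= Nn.
  rewrite -ball_normE /= -rnormE ltcR -rnormN opprB -(subnKC Nn).
  exact: le_lt_trans (un _ _) Ne.
exists l => n; apply/ler_addgt0Pr => e e0.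
have /cvgrPdist_le/(_ e%:C) := ul; rewrite ltcR => /(_ e0)[N _ Ne].
rewrite [leRHS]addrC -{1}[l](subrK (u (n + N)%N)) -addrA.
apply: le_trans (rnorm_triangle _ _) (lerD _ (un _ _)).
by rewrite rnorm_le; apply: Ne => /=; rewrite leq_addl.
Qed.

End geometric_convergence.

Section quadratic_root.
Context {R : realType} {A : cstarType R}.

(** Formally c = 1 - sqrt(1 - b), that is 1 - b = (1 - c)^2; in this form the
    equation makes sense without a unit.  It says that c is fixed by
    F(c) = (b + c^2)/2. *)
Lemma selfadjoint_quadratic_root (b : A) : adj b = b -> rnorm b < 1 ->
  exists2 c : A, adj c = c & b = c + c - c ** c.
Proof.
move=> b_sa b1; pose F (c : A) : A := 2^-1 *: (b + c ** c).
(* The ball of radius r is F-stable, as |b| + r^2 <= 2r, and F is r-Lipschitz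
   on it. *)
pose r := (1 + rnorm b) / 2.
have b0 := rnorm_ge0 b.
have r1 : r < 1 by rewrite /r; lra.
have r0 : 0 <= r by rewrite /r; lra.
have half : complex.Re `|2^-1 : R[i]| = 2^-1.
  rewrite (_ : 2^-1 = (2^-1 : R)%:C); last by rewrite fmorphV rmorph_nat.
  by rewrite normc_def /= expr0n addr0 sqrtr_sqr ger0_norm.
have Fle c : rnorm c <= r -> rnorm (F c) <= r.
  move=> cr; rewrite rnormZ half.
  have : rnorm (b + c ** c) <= rnorm b + r * r.
    apply: le_trans (rnorm_triangle _ _) _; rewrite lerD2l.
    by apply: le_trans (rnormM_le _ _) _; rewrite ler_pM ?rnorm_ge0.
  rewrite /r; nra.
have Fcontr c d : rnorm c <= r -> rnorm d <= r ->
    rnorm (F c - F d) <= r * rnorm (c - d).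
  move=> cr dr; rewrite -scalerBr rnormZ half.
  have -> : b + c ** c - (b + d ** d) = c ** (c - d) + (c - d) ** d.
    by rewrite cmulBr cmulBl addrA subrK opprD addrACA subrr add0r.
  have n0 := rnorm_ge0 (c - d).
  have H1 : rnorm (c ** (c - d)) <= r * rnorm (c - d).
    by apply: le_trans (rnormM_le _ _) _; rewrite ler_wpM2r.
  have H2 : rnorm ((c - d) ** d) <= rnorm (c - d) * r.
    by apply: le_trans (rnormM_le _ _) _; rewrite ler_wpM2l.
  have := rnorm_triangle (c ** (c - d)) ((c - d) ** d); lra.
have F_sa c : adj c = c -> adj (F c) = F c.
  move=> c_sa; rewrite /F Defs.adjZ adjD adjM b_sa c_sa.
  by rewrite (_ : 2^-1 = (2^-1 : R)%:C) ?conjc_real// fmorphV rmorph_nat.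
pose u n := iter n F 0.
have uS n : u n.+1 = F (u n) by [].
have u_r n : rnorm (u n) <= r.
  by elim: n => [|n IH]; [rewrite /rnorm normr0|rewrite uS Fle].
have adj0 : adj 0 = 0 :> A.
  by rewrite -[X in adj X](scale0r 0) Defs.adjZ rmorph0 scale0r.
have u_sa n : adj (u n) = u n by elim: n => [//|n IH]; rewrite uS F_sa.
have [|n|l ul] := @geometric_limit _ _ u r; first exact/andP.
  elim: n => [|n IH]; first by rewrite subr0 expr0 (le_trans (u_r _))// ltW.
  by rewrite exprS (le_trans (Fcontr _ _ (u_r n.+1) (u_r n)))// ler_wpM2l.
have r01 : 0 <= r < 1 by exact/andP.
have l_r : rnorm l <= r.
  apply: (ler_geometric_tail (K := (1 - r)^-1) r01) => n.
  by rewrite -(subrK (u n) l) addrC (le_trans (rnorm_triangle _ _))// lerD.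
have l_uniq (l' : A) K : (forall n, rnorm (l' - u n) <= K * r ^+ n) -> l' = l.
  move=> l'u; apply/eqP; rewrite -subr_eq0; apply/eqP/rnorm_eq0/eqP.
  rewrite eq_le rnorm_ge0 andbT.
  apply: (ler_geometric_tail (K := K + (1 - r)^-1) r01) => n.
  rewrite (_ : l' - l = (l' - u n) + (u n - l)); last by rewrite addrA subrK.
  rewrite add0r mulrDl (le_trans (rnorm_triangle _ _))// lerD//.
  by rewrite -rnormN opprB.
(* Both adj l and F l are limits of the iterates, so they coincide with l. *)
exists l.
  apply: (l_uniq _ (1 - r)^-1) => n.
  rewrite -[in X in rnorm X]u_sa.
  have -> : adj l - adj (u n) = adj (l - u n).
    by rewrite adjD -[- u n]scaleN1r Defs.adjZ rmorphN rmorph1 scaleN1r.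
  by rewrite rnorm_adj.
have Fl : F l = l.
  apply: (l_uniq _ (1 - r)^-1) => -[|n]; last first.
    by rewrite uS exprS mulrCA (le_trans (Fcontr _ _ l_r (u_r _)))// ler_wpM2l.
  rewrite subr0 expr0 mulr1 (le_trans (Fle _ l_r))//.
  by rewrite (le_trans (ltW r1))// invf_ge1 ?subr_gt0// gerBl.
rewrite -{1 2}Fl -scalerDl (_ : 2^-1 + 2^-1 = 1).
  by rewrite scale1r addrK.
by rewrite [RHS]splitr div1r.
Qed.

End quadratic_root.

(** * The form of an algebraic tensor product of Hilbert spaces *)

Section hilbert_space.
Context {R : realType} {H : hilbertSpace R}.
Implicit Types x y z : H.

Lemma ipDl x y z : ip (x + y) z = ip x z + ip y z.
Proof. by rewrite -[x]scale1r ip_linear mul1r scale1r. Qed.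

Lemma ip0l z : ip 0 z = 0.
Proof. by apply: (addrI (ip 0 z)); rewrite -ipDl !addr0. Qed.

Lemma ipZl c x z : ip (c *: x) z = c * ip x z.
Proof. by rewrite -[c *: x]addr0 ip_linear ip0l addr0. Qed.

Lemma ipDr x y z : ip x (y + z) = ip x y + ip x z.
Proof. by rewrite ip_conj ipDl rmorphD /= -!ip_conj. Qed.

Lemma ipZr c x z : ip x (c *: z) = conjc c * ip x z.
Proof. by rewrite ip_conj ipZl rmorphM /= -ip_conj. Qed.

Lemma ip0r x : ip x 0 = 0.
Proof. by rewrite ip_conj ip0l rmorph0. Qed.

Lemma ipNl x y : ip (- x) y = - ip x y.
Proof. by rewrite -scaleN1r ipZl mulN1r. Qed.

Lemma ipNr x y : ip x (- y) = - ip x y.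
Proof. by rewrite ip_conj ipNl rmorphN /= -ip_conj. Qed.

Lemma ip_suml (I : Type) (s : seq I) (F : I -> H) z :
  ip (\sum_(i <- s) F i) z = \sum_(i <- s) ip (F i) z.
Proof. by elim/big_rec2: _ => [|i _ x _ <-]; rewrite ?ip0l ?ipDl. Qed.

Lemma ip_sumr (I : Type) (s : seq I) (F : I -> H) x :
  ip x (\sum_(i <- s) F i) = \sum_(i <- s) ip x (F i).
Proof. by elim/big_rec2: _ => [|i _ y _ <-]; rewrite ?ip0r ?ipDr. Qed.

Lemma ip_ge0 x : 0 <= ip x x.
Proof. by rewrite ip_norm exprn_ge0. Qed.

End hilbert_space.

Section formal_sums.
Context {R : realType}.

Definition formal_sqnorm (H K : hilbertSpace R) (v : seq (H * K)) : R[i] :=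
  \sum_(p <- v) \sum_(q <- v) ip p.1 q.1 * ip p.2 q.2.

Lemma formal_normE (H K : hilbertSpace R) (v : seq (H * K)) :
  formal_norm v = Num.sqrt (complex.Re (formal_sqnorm v)).
Proof. by []. Qed.

(** The vectors of H are orthogonalised against the first of them, x: writing
    p.1 = (p.1 - a p *: x) + a p *: x splits off <x, x> times the squared norm
    of \sum_p a p *: p.2.  In the formal sum that remains, the first term is 0
    and can be dropped, so induction on the number of terms applies. *)
Lemma formal_sqnorm_ge0 (H K : hilbertSpace R) (v : seq (H * K)) :
  0 <= formal_sqnorm v.
Proof.
(* The induction is on the size because perp changes the terms of the tail. *)
have [n] := ubnP (size v); elim: n v => // n IH [|[x y] v] /= vn.
  by rewrite /formal_sqnorm big_nil.
(* If x = 0 then k = 0, and the convention z / 0 = 0 makes a vanish. *)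
pose k := ip x x.
pose a (p : H * K) := ip p.1 x / k.
have aE p : ip p.1 x = a p * k.
  have [k0|k0] := eqVneq k 0; last by rewrite divfK.
  suff -> : x = 0 by rewrite ip0r k0 mulr0.
  by apply/eqP; rewrite -normr_eq0 -sqrf_eq0 -ip_norm -/k k0.
pose perp (p : H * K) := (p.1 - a p *: x, p.2).
have ipE p q : ip p.1 q.1 = ip (perp p).1 (perp q).1 + a p * conjc (a q) * k.
  have kC : conjc k = k by rewrite /k -ip_conj.
  have xq : ip x q.1 = conjc (a q) * k by rewrite ip_conj aE rmorphM /= kC.
  rewrite /= ipDl !ipDr !ipNl !ipNr !ipZl !ipZr xq aE -/k; ring.
have -> : formal_sqnorm ((x, y) :: v) = formal_sqnorm [seq perp p | p <- v]
    + k * ip (\sum_(p <- (x, y) :: v) a p *: p.2)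
             (\sum_(p <- (x, y) :: v) a p *: p.2).
  have perp_xy q : ip (perp (x, y)).1 q = 0.
    rewrite /= /a /= -/k; have [k0|k0] := eqVneq k 0; last first.
      by rewrite divff// scale1r subrr ip0l.
    suff -> : x = 0 by rewrite scaler0 subrr ip0l.
    by apply/eqP; rewrite -normr_eq0 -sqrf_eq0 -ip_norm -/k k0.
  have -> : formal_sqnorm [seq perp p | p <- v] =
      formal_sqnorm [seq perp p | p <- (x, y) :: v].
    rewrite /formal_sqnorm map_cons [RHS]big_cons.
    rewrite [X in _ = X + _]big1 => [|q _]; last by rewrite perp_xy mul0r.
    rewrite add0r; apply: eq_bigr => p _; rewrite [RHS]big_cons.
    by rewrite [X in X * _]ip_conj perp_xy rmorph0 mul0r add0r.
  rewrite /formal_sqnorm big_map ip_suml mulr_sumr -big_split.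
  apply: eq_bigr => p _; rewrite big_map ip_sumr mulr_sumr -big_split.
  apply: eq_bigr => q _ /=.
  rewrite ipZl ipZr ipE /=; ring.
by rewrite addr_ge0 ?mulr_ge0 ?ip_ge0// IH// size_map.
Qed.

Lemma formal_sqnorm_swap (H K : hilbertSpace R) (v : seq (H * K)) :
  formal_sqnorm [seq (p.2, p.1) | p <- v] = formal_sqnorm v.
Proof.
rewrite /formal_sqnorm big_map; apply: eq_bigr => p _.
by rewrite big_map; apply: eq_bigr => q _; rewrite mulrC.
Qed.

(** The hypothesis says that s - f^* f = T^* T; hence the difference of the two
    sides is the squared norm of (T (x) 1) v. *)
Lemma formal_sqnorm_mapl_le (H H' K : hilbertSpace R) (f : H -> H')
    (T : H -> H) (s : R) (v : seq (H * K)) :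
  (forall p q, s%:C * ip p q - ip (f p) (f q) = ip (T p) (T q)) ->
  formal_sqnorm [seq (f p.1, p.2) | p <- v] <= s%:C * formal_sqnorm v.
Proof.
move=> fT; rewrite -subr_ge0.
suff -> : s%:C * formal_sqnorm v - formal_sqnorm [seq (f p.1, p.2) | p <- v]
    = formal_sqnorm [seq (T p.1, p.2) | p <- v] by exact: formal_sqnorm_ge0.
rewrite /formal_sqnorm !big_map mulr_sumr -sumrB; apply: eq_bigr => p _.
rewrite !big_map mulr_sumr -sumrB; apply: eq_bigr => q _ /=.
by rewrite mulrA -mulrBl fT.
Qed.

Lemma formal_sqnorm_mapr_le (H K K' : hilbertSpace R) (g : K -> K')
    (T : K -> K) (s : R) (v : seq (H * K)) :
  (forall p q, s%:C * ip p q - ip (g p) (g q) = ip (T p) (T q)) ->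
  formal_sqnorm [seq (p.1, g p.2) | p <- v] <= s%:C * formal_sqnorm v.
Proof.
move=> gT; have := formal_sqnorm_mapl_le [seq (p.2, p.1) | p <- v] gT.
by rewrite formal_sqnorm_swap -[leLHS]formal_sqnorm_swap -!map_comp.
Qed.

End formal_sums.

(** * Representations and the norm of elementary tensors *)

Section representations.
Context {R : realType} {A : cstarType R} {H : hilbertSpace R}.
Variable pi : representation A H.

Lemma rep0 x : pi 0 x = 0.
Proof.
apply: (addrI (pi 0 x)); rewrite -{1}[pi 0 x]scale1r -rep_linear.
by rewrite scaler0 !addr0.
Qed.

Lemma repD a b x : pi (a + b) x = pi a x + pi b x.
Proof. by rewrite -{1}[a]scale1r rep_linear scale1r. Qed.

Lemma repZ (c : R[i]) a x : pi (c *: a) x = c *: pi a x.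
Proof. by rewrite -[c *: a]addr0 rep_linear rep0 addr0. Qed.

Lemma repN a x : pi (- a) x = - pi a x.
Proof. by rewrite -scaleN1r repZ scaleN1r. Qed.

(** Let b = s^-1 a, so that |b^* b| < 1, and let c solve b^* b = 2c - c^2.  Then
    1 - pi(b^* b) = (1 - pi(c))^2, so T = s (1 - pi(c)) works.  Unlike the
    inequality |pi(a) x| <= s |x|, this identity of forms can be tensored with
    another Hilbert space. *)
Lemma rep_defect (a : A) (s : R) : rnorm a < s ->
  exists T : H -> H,
    forall x y, (s ^+ 2)%:C * ip x y - ip (pi a x) (pi a y) = ip (T x) (T y).
Proof.
move=> a_s; have s0 : 0 < s by exact: le_lt_trans (rnorm_ge0 _) a_s.
have sC0 : s%:C != 0 :> R[i] by rewrite (inj_eq (@complexI R)) gt_eqF.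
pose b := (s%:C ^-1) *: a.
have rb : rnorm b < 1.
  rewrite rnormZ -fmorphV normc_def /= expr0n addr0 sqrtr_sqr.
  by rewrite gtr0_norm ?invr_gt0// ltr_pdivrMl// mulr1.
have [||c c_sa bE] := @selfadjoint_quadratic_root _ _ (adj b ** b).
- by rewrite adjM adjK.
- by rewrite (le_lt_trans (rnormM_le _ _))// rnorm_adj mulr_ilt1 ?rnorm_ge0.
exists (fun x => s%:C *: (x - pi c x)) => x y.
have E : ip x y - ip (pi b x) (pi b y) = ip (x - pi c x) (y - pi c y).
  rewrite rep_adj -repM bE !repD repN repM.
  rewrite !ipDl !ipDr !ipNl !ipNr !(rep_adj pi c) c_sa; ring.
have piE z : pi a z = s%:C *: pi b z by rewrite repZ scalerA divff// scale1r.
by rewrite !piE !ipZl !ipZr -E conjc_real rmorphXn /=; ring.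
Qed.

End representations.

Section elementary_tensors.
Context {R : realType} {M : minTensor R} {A B : cstarType R}.

Lemma formal_norm_rep_le (H K : hilbertSpace R) (pi : representation A H)
    (sigma : representation B K) (a : A) (b : B) (s t : R) (v : seq (H * K)) :
  rnorm a < s -> rnorm b < t ->
  formal_norm [seq (pi a p.1, sigma b p.2) | p <- v] <= s * t * formal_norm v.
Proof.
move=> a_s b_t.
have s0 : 0 < s by exact: le_lt_trans (rnorm_ge0 _) a_s.
have t0 : 0 < t by exact: le_lt_trans (rnorm_ge0 _) b_t.
have [T piT] := rep_defect pi a_s; have [U sigmaU] := rep_defect sigma b_t.
have : formal_sqnorm [seq (pi a p.1, sigma b p.2) | p <- v] <=
    ((s * t) ^+ 2)%:C * formal_sqnorm v.
  have := formal_sqnorm_mapl_le [seq (p.1, sigma b p.2) | p <- v] piT.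
  rewrite -map_comp => /le_trans; apply.
  have -> : ((s * t) ^+ 2)%:C = (s ^+ 2)%:C * (t ^+ 2)%:C :> R[i].
    by rewrite exprMn rmorphM.
  rewrite -mulrA ler_wpM2l//; first by rewrite ler0c sqr_ge0.
  exact: formal_sqnorm_mapr_le sigmaU.
rewrite lecE => /andP[_]; rewrite !formal_normE.
have -> : complex.Re (((s * t) ^+ 2)%:C * formal_sqnorm v) =
    (s * t) ^+ 2 * complex.Re (formal_sqnorm v).
  by case: (formal_sqnorm v) => x y /=; rewrite mul0r subr0.
move=> /ler_wsqrtr/le_trans; apply.
by rewrite sqrtrM ?sqr_ge0// sqrtr_sqr ger0_norm// mulr_ge0 ?ltW.
Qed.

(** The strict bounds s and t of [formal_norm_rep_le] are let tend to |a| and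
    |b|. *)
Lemma rnorm_pure_le (a : A) (b : B) :
  rnorm (mt_pure (m := M) a b) <= rnorm a * rnorm b.
Proof.
suff st (s t : R) : rnorm a < s -> rnorm b < t ->
    rnorm (mt_pure (m := M) a b) <= s * t.
  have sb s : rnorm a < s -> rnorm (mt_pure (m := M) a b) <= s * rnorm b.
    move=> a_s; have s0 : 0 < s by exact: le_lt_trans (rnorm_ge0 _) a_s.
    rewrite -ler_pdivrMl//; apply/ler_addgt0Pr => t t0.
    by rewrite ler_pdivrMl// st// ltrDl.
  have [b0|b0] := eqVneq (rnorm b) 0.
    by rewrite b0 mulr0 -(mulr0 (rnorm a + 1)) -b0 sb// ltrDl.
  have {}b0 : 0 < rnorm b by rewrite lt_neqAle eq_sym b0 rnorm_ge0.
  rewrite -ler_pdivrMr//; apply/ler_addgt0Pr => s s0.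
  by rewrite ler_pdivrMr// sb// ltrDl.
move=> a_s b_t.
have s0 := le_lt_trans (rnorm_ge0 _) a_s.
have t0 := le_lt_trans (rnorm_ge0 _) b_t.
have := mt_norm M [:: (a, b)]; rewrite big_seq1 /= => ab.
rewrite -lee_fin ab; apply: ge_ereal_sup => _ [H [K [pi [sigma [v [v1 ->]]]]]].
rewrite lee_fin /= cats0 (le_trans (formal_norm_rep_le _ _ _ a_s b_t))//.
by rewrite ler_piMr// mulr_ge0 ?ltW.
Qed.

End elementary_tensors.

(** * Closed linear spans *)

Section closed_spans.
Context {R : realType}.
Implicit Types V W : normedModType R[i].

(** The set of which [closed_span S] is the closure. *)
Definition lspan V (S : set V) : set V :=
  [set v | exists2 s : seq (R[i] * V),
    (forall p, p \in s -> S p.2) & v = \sum_(p <- s) p.1 *: p.2].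

Lemma lspan_lin V (S : set V) c x y :
  lspan S x -> lspan S y -> lspan S (c *: x + y).
Proof.
move=> [s Ss ->] [t St ->].
exists ([seq (c * p.1, p.2) | p <- s] ++ t) => [p|].
  by rewrite mem_cat => /orP[/mapP[q /Ss ? ->]|/St].
rewrite big_cat big_map scaler_sumr; congr (_ + _).
by apply: eq_bigr => p _ /=; rewrite scalerA.
Qed.

Lemma closed_spanP V (S : set V) x :
  closed_span S x <->
  forall e : R, 0 < e -> exists2 y, lspan S y & rnorm (x - y) <= e.
Proof.
split=> [Sx e e0|Sx].
  have [|y [Sy xy]] := Sx (ball x e%:C).
    by apply: nbhsx_ballx; rewrite ltcR.
  exists y => //; rewrite rnorm_le ltW//.
  by move: xy; rewrite -ball_normE.
move=> U /nbhs_ballP[_ /ltcR_ex[e e0 <-] eU].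
have e20 : 0 < e / 2 by rewrite divr_gt0.
have [y Sy xy] := Sx _ e20; exists y; split=> //; apply: eU.
rewrite -ball_normE /= -rnormE ltcR (le_lt_trans xy)//.
by rewrite ltr_pdivrMr// ltr_pMr// ltr1n.
Qed.

Lemma closed_span_lin V (S : set V) c x y :
  closed_span S x -> closed_span S y -> closed_span S (c *: x + y).
Proof.
move=> /closed_spanP Sx /closed_spanP Sy; apply/closed_spanP => e e0.
pose k := complex.Re `|c|.
have k0 : 0 <= k by exact: (rnorm_ge0 (c : R[i]^o)).
have [|x' Sx' xx'] := Sx (e / 2 / (k + 1)).
  by rewrite !divr_gt0// ltr_wpDl.
have [|y' Sy' yy'] := Sy (e / 2); first by rewrite divr_gt0.
exists (c *: x' + y'); first exact: lspan_lin.
rewrite opprD addrACA -scalerBr [leRHS]splitr.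
apply: le_trans (rnorm_triangle _ _) (lerD _ yy').
rewrite rnormZ -/k.
apply: (@le_trans _ _ ((k + 1) * (e / 2 / (k + 1)))).
  by rewrite ler_pM ?rnorm_ge0 ?lerDl.
by rewrite mulrC divfK// gt_eqF// ltr_wpDl.
Qed.

Lemma closed_span0 V (S : set V) : closed_span S 0.
Proof.
apply/closed_spanP => e e0; exists 0; first by exists [::]; rewrite ?big_nil.
by rewrite subrr /rnorm normr0 ltW.
Qed.

Lemma sub_closed_span V (S : set V) : S `<=` closed_span S.
Proof.
move=> x Sx; apply/closed_spanP => e e0; exists x; last first.
  by rewrite subrr /rnorm normr0 ltW.
exists [:: (1, x)]; rewrite ?big_seq1 ?scale1r// => p.
by rewrite inE => /eqP ->.
Qed.

Lemma closed_span_sum V (S : set V) (I : Type) (s : seq I) (F : I -> V) :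
  (forall i, closed_span S (F i)) -> closed_span S (\sum_(i <- s) F i).
Proof.
move=> SF; apply: big_ind => // [|x y Sx Sy]; first exact: closed_span0.
by rewrite -[x]scale1r; exact: closed_span_lin.
Qed.

Lemma closed_span_map V W (S : set V) (S' : set W) (L : V -> W) :
  linear L -> continuous L -> (forall x, S x -> closed_span S' (L x)) ->
  forall x, closed_span S x -> closed_span S' (L x).
Proof.
move=> Llin Lcont LS x Sx.
have LD c y z : L (c *: y + z) = c *: L y + L z by exact: Llin.
have L0 : L 0 = 0.
  by apply: (addrI (L 0)); rewrite -{1}[L 0]scale1r -LD scaler0 !addr0.
have : closed (L @^-1` closed_span S').
  by apply: closed_comp => [y _|]; [exact: Lcont|exact: closed_closure].
move=> /closure_id.
rewrite -[closed_span S' _]/((L @^-1` closed_span S') x) => ->.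
apply: closureS Sx => _ [s Ss ->] /=.
elim: s Ss => [_|[c y] s IH Ss].
  by rewrite big_nil L0; exact: closed_span0.
rewrite big_cons LD; apply: closed_span_lin.
  by apply: LS; apply: (Ss (c, y)); rewrite mem_head.
by apply: IH => p ps; apply: Ss; rewrite inE ps orbT.
Qed.

Lemma bounded_linear_continuous V W (L : V -> W) (k : R) :
  linear L -> (forall x, rnorm (L x) <= k * rnorm x) -> continuous L.
Proof.
move=> Llin Lk x; apply/cvgrPdist_le => _ /ltcR_ex[e e0 <-].
have LB y z : L (y - z) = L y - L z.
  by rewrite addrC -scaleN1r Llin scaleN1r addrC.
have k1 : 0 < `|k| + 1 by rewrite ltr_wpDl.
near=> y; rewrite -rnorm_le -LB (le_trans (Lk _))//.
apply: (@le_trans _ _ ((`|k| + 1) * rnorm (x - y))).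
  by rewrite ler_wpM2r ?rnorm_ge0// (le_trans (ler_norm _))// lerDl.
rewrite -ler_pdivlMl// rnorm_le; near: y.
move: (@cvg_id _ (nbhs x)) => /cvgrPdist_le; apply.
by rewrite ltcR mulr_gt0// invr_gt0.
Unshelve. all: by end_near. Qed.

Lemma cmul_left_continuous (B : cstarType R) (a : B) : continuous (cmul a).
Proof.
by apply: (bounded_linear_continuous (k := rnorm a));
  [exact: cmul_left_linear|exact: rnormM_le].
Qed.

End closed_spans.

(** * The square root of t *)

Section square_root_of_t.
Context (R : realType).

(** Its square is t, so that t is a product of two functions of
    C_0((0, 1]), as [equivariant_canonical_span] requires. *)
Definition sqrt_t_fun (x : Ioc01 R) : R[i]^o := (Num.sqrt (set_val x))%:C.

Lemma sqrt_t_subproof : sqrt_t_fun \in @C0_pred R (Ioc01 R).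
Proof.
have n_sqrt x : rnorm (sqrt_t_fun x) = Num.sqrt (set_val x).
  by rewrite /rnorm normc_def /= expr0n addr0 sqrtr_sqr ger0_norm ?sqrtr_ge0.
have n_t x : rnorm (tC0 R x) = set_val x.
  have := set_valP x; rewrite /= => /andP[x0 _].
  by rewrite /rnorm normc_def /= expr0n addr0 sqrtr_sqr gtr0_norm.
apply/C0_predP; split=> [x|e e0].
  apply/(@cvgrPdist_le _ _ _ (nbhs x)) => _ /ltcR_ex[e e0 <-].
  have sc : Num.sqrt (set_val y : R) @[y --> x] --> Num.sqrt (set_val x : R).
    have vc : (set_val : Ioc01 R -> R) y @[y --> x] --> (set_val x : R).
      exact: initial_continuous.
    exact: (continuous_cvg _ (@sqrt_continuous R _) vc).
  have xe : \forall y \near x,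
      `|Num.sqrt (set_val x) - Num.sqrt (set_val y)| <= e.
    by move/cvgrPdist_le: sc; apply.
  near=> y; rewrite /sqrt_t_fun -rmorphB normc_def /= expr0n addr0.
  rewrite sqrtr_sqr lecR.
  by near: y.
have e20 : 0 < e ^+ 2 by rewrite exprn_gt0.
(* sqrt x >= e if and only if x >= e^2, and t vanishes at infinity. *)
rewrite (_ : [set _ | _] = [set x | e ^+ 2 <= rnorm (tC0 R x)]).
  exact: (C0_vanishing (f := tC0 R) e20).
apply/seteqP; split=> x /=; rewrite n_sqrt n_t => ex.
  rewrite -[leRHS]sqr_sqrtr -?n_t ?rnorm_ge0// n_t.
  by rewrite ler_pXn2r ?nnegrE ?sqrtr_ge0// ltW.
by have := ler_wsqrtr ex; rewrite sqrtr_sqr gtr0_norm.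
Unshelve. all: by end_near. Qed.

Definition sqrt_tC0 : C0 R (Ioc01 R) := MkC0 sqrt_t_subproof.

Lemma sqrt_tC0K : sqrt_tC0 ** sqrt_tC0 = tC0 R.
Proof.
apply/val_inj/funext => x /=.
have := set_valP x; rewrite /= => /andP[x0 _].
rewrite /sqrt_t_fun -[LHS]rmorphM /= -expr2 sqr_sqrtr//; exact: ltW.
Qed.

End square_root_of_t.

(** * Freeness *)

Section freeness.
Context (R : realType) (M : minTensor R) (G : compactQuantumGroup M).
Context (A : ucstarType R) (delta : action G A).

Definition canonical_span : set (mt_obj M A G) := closed_span [set x |
  exists a b : A, x = mt_pure a uone ** delta b].

Lemma canonical_span_lmul (c : A) x :
  canonical_span x -> canonical_span (mt_pure c uone ** x).
Proof.
apply: closed_span_map; [exact: cmul_left_linear|exact: cmul_left_continuous|].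
move=> _ [a [b ->]]; apply: sub_closed_span; exists (c ** a), b.
by rewrite cmulA mt_pureM cmul1.
Qed.

(** By density and continuity it suffices to take x = (a (x) 1) Delta(b); then
    equivariance identifies the element with
    (rho(f (x) a) (x) 1) delta(rho(g (x) b)). *)
Lemma equivariant_canonical_span
    (rho : starHom (mt_obj M (C0 R (Ioc01 R)) G) A)
    (f g : C0 R (Ioc01 R)) (x : mt_obj M G G) :
  equivariant (@cone_coact _ M G) delta rho ->
  canonical_span (mt_map rho (hom_id G) (mt_assoc (mt_pure (f ** g) x))).
Proof.
move=> rho_eq.
pose L y := mt_map rho (hom_id G) (mt_assoc (mt_pure (m := M) (f ** g) y)).
have Llin : linear L by move=> c y z; rewrite /L mt_linearr !linearP.
have Lcont : continuous L.
  have pc : continuous (mt_pure (m := M) (B := mt_obj M G G) (f ** g)).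
    apply: (bounded_linear_continuous (k := rnorm (f ** g))).
      exact: mt_linearr.
    by move=> y; exact: rnorm_pure_le.
  move=> y; apply: (@continuous_comp _ _ _ _
    (fun z => mt_map rho (hom_id G) (mt_assoc z)) y (pc y)).
  by apply: continuous_comp; [exact: mt_assoc_cont|exact: mt_map_cont].
apply: (closed_span_map Llin Lcont (S := [set x : mt_obj M G G |
    exists a b : G, x = mt_pure a uone ** comult G b])); last first.
  by rewrite comult_densel.
move=> _ [a [b ->]]; apply: sub_closed_span.
exists (rho (mt_pure f a)), (rho (mt_pure g b)).
by rewrite rho_eq /cone_coact mt_mapE /L -mt_pureM !homM mt_assocE mt_mapE.
Qed.

End freeness.

Theorem theorem3p8 (R : realType) (M : minTensor R)
    (G : compactQuantumGroup M) (A : ucstarType R) (delta : action G A) :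
  (dim_WLT delta < +oo)%E -> free_action delta.
Proof.
move=> dim_fin.
have [d [rho [rho_eq [c [_ cK]]]]] : exists d, WLT_le delta d.
  apply: contrapT => /forallNP noWLT; move: dim_fin; rewrite /dim_WLT.
  rewrite (_ : [set _ | _ in _] = set0) ?ereal_inf0 ?ltxx//.
  by apply/seteqP; split=> // x [d /noWLT].
have one_h (h : G) : canonical_span delta (mt_pure uone h).
  have pureDl : linear (fun a : A => mt_pure (m := M) a h) by exact: mt_linearl.
  rewrite -cK -[h]cmul1 -mt_pureM; apply: canonical_span_lmul.
  have -> : mt_pure (m := M) (\sum_(j < d.+1) rho j (mt_pure (tC0 R) uone)) h =
      \sum_(j < d.+1) mt_pure (rho j (mt_pure (tC0 R) uone)) h.
    have p0 : mt_pure (m := M) (0 : A) h = 0.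
      apply: (addrI (mt_pure (0 : A) h)).
      by rewrite -{1}[mt_pure 0 h]scale1r -pureDl scaler0 !addr0.
    apply: (big_morph (fun a : A => mt_pure (m := M) a h)) => // a b.
    by rewrite -{1}[a]scale1r pureDl scale1r.
  apply: closed_span_sum => j.
  have := equivariant_canonical_span (f := sqrt_tC0 R) (g := sqrt_tC0 R)
    (x := mt_pure uone h) (rho_eq j).
  by rewrite sqrt_tC0K mt_assocE mt_mapE.
apply/seteqP; split=> // x _.
have : closed_span [set x : mt_obj M A G | exists a b, x = mt_pure a b] x.
  by rewrite mt_dense.
apply: (@closed_span_map _ _ _ _ _ id) => //; first by move=> y; exact: cvg_id.
move=> _ [a [h ->]].
by rewrite -[a]cmulr1 -[h]cmul1 -mt_pureM; exact: canonical_span_lmul.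
Qed.
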